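(* The group $Q(2,1)$ is isomorphic to the trefoil knot group $T \cong \langle x, y : xyx = yxy \rangle$.
   Context: $Q(2,1)$ is the group with generators $x_0, x_1$ and the two relators $u\,\theta(u)$ and $\theta(u)\,u$, where $u = x_0 x_1 x_0^{-1} x_1^{-2}$ and $\theta$ is the automorphism of the free group $F(x_0,x_1)$ interchanging $x_0$ and $x_1$. *)

(* Defs.v *)
From HB Require Import structures.
From mathcomp Require Import ssreflect ssrfun ssrbool eqtype ssrnat seq choice.
From mathcomp Require Import fintype generic_quotient monoid.
From mathcomp Require Import boolp classical_sets.

Set Implicit Arguments.
Unset Strict Implicit.
Unset Printing Implicit Defensive.


Local Open Scope group_scope.
Local Open Scope quotient_scope.

Section FreeGroup.
Variable X : choiceType.

(* The letter (x, false) stands for x and (x, true) for x^-1. *)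
Definition word := seq (X * bool).

Inductive free_eq : word -> word -> Prop :=
| FreeCancel w1 x b w2 : free_eq (w1 ++ (x, b) :: (x, ~~ b) :: w2) (w1 ++ w2)
| FreeRefl w : free_eq w w
| FreeSym w1 w2 : free_eq w1 w2 -> free_eq w2 w1
| FreeTrans w1 w2 w3 : free_eq w1 w2 -> free_eq w2 w3 -> free_eq w1 w3.

Definition free_eqb : rel word := fun w1 w2 => `[< free_eq w1 w2 >].

Lemma free_eqb_equiv : equiv_class_of free_eqb.
Proof.
split=> [w|w1 w2|w2 w1 w3].
- exact/asboolP/FreeRefl.
- by apply/asboolP/asboolP => /FreeSym.
- by move=> /asboolP e12 /asboolP e23; apply/asboolP/(FreeTrans e12).
Qed.

Canonical free_eqb_equiv_rel := EquivRelPack free_eqb_equiv.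

Definition freeGroup := {eq_quot free_eqb}.
HB.instance Definition _ := Choice.on freeGroup.
HB.instance Definition _ := EqQuotient.on freeGroup.

Definition free_pi (w : word) : freeGroup := \pi w.

Lemma free_piW (P : freeGroup -> Prop) :
  (forall w, P (free_pi w)) -> forall g, P g.
Proof. exact: quotW. Qed.

Lemma free_pi_eq (w1 w2 : word) :
  free_pi w1 = free_pi w2 <-> free_eq w1 w2.
Proof.
split; last by move=> e12; apply/eqmodP/asboolP.
by move/eqmodP/asboolP.
Qed.

Lemma free_eq_cat u1 u2 v1 v2 :
  free_eq u1 u2 -> free_eq v1 v2 -> free_eq (u1 ++ v1) (u2 ++ v2).
Proof.
move=> eu ev; apply: (@FreeTrans _ (u2 ++ v1)).
  elim: eu => [w1 x b w2|w|w1 w2 _|w1 w2 w3 _ e12 _ e23].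
  - by rewrite -!catA /=; apply: FreeCancel.
  - exact: FreeRefl.
  - exact: FreeSym.
  - exact: FreeTrans e12 e23.
elim: ev => [w1 x b w2|w|w1 w2 _|w1 w2 w3 _ e12 _ e23].
- by rewrite !catA; apply: FreeCancel.
- exact: FreeRefl.
- exact: FreeSym.
- exact: FreeTrans e12 e23.
Qed.

Definition inv_word (w : word) : word := rev [seq (l.1, ~~ l.2) | l <- w].

Lemma inv_word_cat w1 w2 : inv_word (w1 ++ w2) = inv_word w2 ++ inv_word w1.
Proof. by rewrite /inv_word map_cat rev_cat. Qed.

Lemma inv_wordK : involutive inv_word.
Proof.
move=> w; rewrite /inv_word map_rev revK -map_comp -[RHS]map_id.
by apply: eq_map => -[x b] /=; rewrite negbK.
Qed.

Lemma free_eq_inv w1 w2 : free_eq w1 w2 -> free_eq (inv_word w1) (inv_word w2).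
Proof.
elim=> {w1 w2} [w1 x b w2|w|w1 w2 _|w1 w2 w3 _ e12 _ e23].
  rewrite -(cat1s (x, b)) -(cat1s (x, ~~ b)) !inv_word_cat -!catA /= negbK.
  exact: FreeCancel.
- exact: FreeRefl.
- exact: FreeSym.
- exact: FreeTrans e12 e23.
Qed.

Lemma free_eq_mulV w : free_eq (w ++ inv_word w) [::].
Proof.
elim: w => [|[x b] w IHw]; first exact: FreeRefl.
have -> : ((x, b) :: w) ++ inv_word ((x, b) :: w) =
    [:: (x, b)] ++ (w ++ inv_word w) ++ [:: (x, ~~ b)].
  by rewrite -(cat1s (x, b) w) inv_word_cat -!catA.
apply: (FreeTrans _ (@FreeCancel [::] x b [::])).
apply: (free_eq_cat (FreeRefl _)).
exact: (free_eq_cat IHw (FreeRefl [:: (x, ~~ b)])).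
Qed.

Definition free_mul (g h : freeGroup) : freeGroup :=
  free_pi (repr g ++ repr h).
Definition free_one : freeGroup := free_pi [::].
Definition free_inv (g : freeGroup) : freeGroup :=
  free_pi (inv_word (repr g)).

Lemma free_repr_pi (w : word) : free_eq (repr (free_pi w)) w.
Proof. by apply/free_pi_eq; apply: reprK. Qed.

Lemma free_mul_pi w1 w2 :
  free_mul (free_pi w1) (free_pi w2) = free_pi (w1 ++ w2).
Proof. by apply/free_pi_eq/free_eq_cat; apply: free_repr_pi. Qed.

Lemma free_inv_pi w : free_inv (free_pi w) = free_pi (inv_word w).
Proof. by apply/free_pi_eq/free_eq_inv; apply: free_repr_pi. Qed.

Lemma free_mulA : associative free_mul.
Proof.
elim/free_piW=> g; elim/free_piW=> h; elim/free_piW=> k.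
by rewrite (free_mul_pi h k) (free_mul_pi g h) !free_mul_pi catA.
Qed.

Lemma free_mul1 : left_id free_one free_mul.
Proof. by elim/free_piW=> w; rewrite free_mul_pi. Qed.

Lemma free_mulr1 : right_id free_one free_mul.
Proof. by elim/free_piW=> w; rewrite free_mul_pi cats0. Qed.

Lemma free_mulrV : right_inverse free_one free_inv free_mul.
Proof.
elim/free_piW=> w; rewrite free_inv_pi free_mul_pi.
exact/free_pi_eq/free_eq_mulV.
Qed.

Lemma free_mulV : left_inverse free_one free_inv free_mul.
Proof.
elim/free_piW=> w; rewrite free_inv_pi free_mul_pi -{2}[w]inv_wordK.
exact/free_pi_eq/free_eq_mulV.
Qed.

HB.instance Definition _ := isGroup.Build freeGroup
  free_mulA free_mul1 free_mulr1 free_mulV free_mulrV.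

Definition free_gen (x : X) : freeGroup := free_pi [:: (x, false)].

Lemma free_piM w1 w2 :
  free_pi (w1 ++ w2) = free_pi w1 * free_pi w2.
Proof. by rewrite -free_mul_pi. Qed.

End FreeGroup.

Section FreeLift.
Variables (X : choiceType) (G : groupType) (f : X -> G).

Fixpoint word_eval (w : word X) : G :=
  if w is (x, b) :: w' then (if b then (f x)^-1 else f x) * word_eval w' else 1.

Lemma word_eval_cat w1 w2 : word_eval (w1 ++ w2) = word_eval w1 * word_eval w2.
Proof. by elim: w1 => [|[x b] w1 /= ->]; rewrite ?mul1g ?mulgA. Qed.

Lemma word_eval_free_eq w1 w2 : free_eq w1 w2 -> word_eval w1 = word_eval w2.
Proof.
elim=> [u x [] v|//|//|? ? ? _ -> _ -> //]; rewrite !word_eval_cat /=.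
  by rewrite mulKg.
by rewrite mulVKg.
Qed.

(* The homomorphism freeGroup X -> G extending f. *)
Definition free_lift (g : freeGroup X) : G := word_eval (repr g).

Lemma free_lift_pi w : free_lift (free_pi w) = word_eval w.
Proof. exact/word_eval_free_eq/free_repr_pi. Qed.

Lemma free_liftM : {morph free_lift : g h / g * h}.
Proof.
elim/free_piW=> w1; elim/free_piW=> w2; rewrite -free_piM !free_lift_pi.
exact: word_eval_cat.
Qed.

HB.instance Definition _ :=
  isMultiplicative.Build (freeGroup X) G free_lift free_liftM.

Lemma free_lift_gen x : free_lift (free_gen x) = f x.
Proof. by rewrite free_lift_pi /= mulg1. Qed.

End FreeLift.

Lemma free_morph_ext (X : choiceType) (G : groupType)
    (f g : {multiplicative freeGroup X -> G}) :
  (forall x, f (free_gen x) = g (free_gen x)) -> f =1 g.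
Proof.
move=> efg; have f1 (h : {multiplicative freeGroup X -> G}) : h 1 = 1.
  by apply: (mulgI (h 1)); rewrite -gmulfM !mulg1.
elim/free_piW; elim=> [|[x b] w IHw]; first by rewrite !f1.
have -> : free_pi ((x, b) :: w) = free_pi [:: (x, b)] * free_pi w.
  by rewrite -free_piM.
rewrite !gmulfM IHw; congr (_ * _); case: b; last exact: efg.
have -> : free_pi [:: (x, true)] = (free_gen x)^-1.
  by rewrite -[RHS]/(free_inv _) free_inv_pi.
have fV (h : {multiplicative freeGroup X -> G}) y : h y^-1 = (h y)^-1.
  by apply: (mulgI (h y)); rewrite -gmulfM !mulgV f1.
by rewrite !fV efg.
Qed.

Section QuotientGroup.
Variables (G : groupType) (R : set G).

Inductive normal_closure : G -> Prop :=
| NclIn r : R r -> normal_closure r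
| Ncl1 : normal_closure 1
| NclM g h : normal_closure g -> normal_closure h -> normal_closure (g * h)
| NclV g : normal_closure g -> normal_closure g^-1
| NclJ g h : normal_closure g -> normal_closure (g ^ h).

Definition ncl_eqb : rel G := fun g h => `[< normal_closure (g^-1 * h) >].

Lemma ncl_eqb_equiv : equiv_class_of ncl_eqb.
Proof.
have sym g h : normal_closure (g^-1 * h) -> normal_closure (h^-1 * g).
  by move/NclV; rewrite invgM invgK.
split=> [g|g h|h g k].
- by apply/asboolP; rewrite mulVg; apply: Ncl1.
- by apply/asboolP/asboolP; apply: sym.
- move=> /asboolP gh /asboolP hk; apply/asboolP.
  by have := NclM gh hk; rewrite mulgA mulgK.
Qed.

Canonical ncl_eqb_equiv_rel := EquivRelPack ncl_eqb_equiv.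

(* The quotient of G by the normal closure of R. *)
Definition quotGroup := {eq_quot ncl_eqb}.
HB.instance Definition _ := Choice.on quotGroup.
HB.instance Definition _ := EqQuotient.on quotGroup.

Definition quot_pi (g : G) : quotGroup := \pi g.

Lemma quot_piW (P : quotGroup -> Prop) :
  (forall g, P (quot_pi g)) -> forall a, P a.
Proof. exact: quotW. Qed.

Lemma quot_pi_eq (g h : G) :
  quot_pi g = quot_pi h <-> normal_closure (g^-1 * h).
Proof.
split; last by move=> gh; apply/eqmodP/asboolP.
by move/eqmodP/asboolP.
Qed.

Definition quot_mul (a b : quotGroup) : quotGroup :=
  quot_pi (repr a * repr b).
Definition quot_one : quotGroup := quot_pi 1.
Definition quot_inv (a : quotGroup) : quotGroup := quot_pi (repr a)^-1.

Lemma quot_repr_pi (g : G) : normal_closure ((repr (quot_pi g))^-1 * g).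
Proof. by apply/quot_pi_eq; apply: reprK. Qed.

Lemma quot_mul_pi g h :
  quot_mul (quot_pi g) (quot_pi h) = quot_pi (g * h).
Proof.
apply/quot_pi_eq; have gg' := quot_repr_pi g; have hh' := quot_repr_pi h.
set g' := repr (quot_pi g) in gg' *; set h' := repr (quot_pi h) in hh' *.
have -> : (g' * h')^-1 * (g * h) = (h'^-1 * h) * ((g'^-1 * g) ^ h).
  by rewrite /conjg invgM !mulgA mulgK.
exact: NclM hh' (NclJ _ gg').
Qed.

Lemma quot_inv_pi g : quot_inv (quot_pi g) = quot_pi g^-1.
Proof.
apply/quot_pi_eq; have := quot_repr_pi g; set g' := repr _ => gg'.
have -> : g'^-1^-1 * g^-1 = ((g'^-1 * g) ^ g^-1)^-1.
  by rewrite /conjg mulgK invgM !invgK.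
exact: NclV (NclJ _ gg').
Qed.

Lemma quot_mulA : associative quot_mul.
Proof.
elim/quot_piW=> g; elim/quot_piW=> h; elim/quot_piW=> k.
by rewrite (quot_mul_pi h k) (quot_mul_pi g h) !quot_mul_pi mulgA.
Qed.

Lemma quot_mul1 : left_id quot_one quot_mul.
Proof. by elim/quot_piW=> g; rewrite quot_mul_pi mul1g. Qed.

Lemma quot_mulr1 : right_id quot_one quot_mul.
Proof. by elim/quot_piW=> g; rewrite quot_mul_pi mulg1. Qed.

Lemma quot_mulV : left_inverse quot_one quot_inv quot_mul.
Proof. by elim/quot_piW=> g; rewrite quot_inv_pi quot_mul_pi mulVg. Qed.

Lemma quot_mulrV : right_inverse quot_one quot_inv quot_mul.
Proof. by elim/quot_piW=> g; rewrite quot_inv_pi quot_mul_pi mulgV. Qed.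

HB.instance Definition _ := isGroup.Build quotGroup
  quot_mulA quot_mul1 quot_mulr1 quot_mulV quot_mulrV.

End QuotientGroup.

Definition presentedGroup (X : choiceType) (R : set (freeGroup X)) : groupType :=
  quotGroup R.

Definition x0 : freeGroup 'I_2 := free_gen (ord0 : 'I_2).
Definition x1 : freeGroup 'I_2 := free_gen (ord_max : 'I_2).

Definition theta : freeGroup 'I_2 -> freeGroup 'I_2 :=
  free_lift (fun i : 'I_2 => free_gen (rev_ord i)).
HB.instance Definition _ := Multiplicative.on theta.

Lemma theta_x0 : theta x0 = x1.
Proof. by rewrite /theta free_lift_gen; congr free_gen; apply: val_inj. Qed.

Lemma theta_x1 : theta x1 = x0.
Proof. by rewrite /theta free_lift_gen; congr free_gen; apply: val_inj. Qed.

Lemma thetaK : involutive theta.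
Proof.
apply: (@free_morph_ext _ _ (theta \o theta) idfun) => i /=.
by rewrite /theta !free_lift_gen rev_ordK.
Qed.

Definition u : freeGroup 'I_2 := x0 * x1 * x0^-1 * x1 ^- 2.

Definition Q21 : groupType :=
  presentedGroup [set r | r = u * theta u \/ r = theta u * u]%classic.

(* The relation xyx = yxy is the relator xyx(yxy)^-1; here x, y are x0, x1. *)
Definition trefoilGroup : groupType :=
  presentedGroup [set r | r = (x0 * x1 * x0) * (x1 * x0 * x1)^-1]%classic.

(* Main.v *)
Require Import Defs.
From HB Require Import structures.
From mathcomp Require Import ssreflect ssrfun ssrbool eqtype choice fintype.
From mathcomp Require Import generic_quotient monoid.
From mathcomp Require Import classical_sets.

(** Substituting [x1 := y^-1], the relator [u * theta u] is conjugate to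
    [y^-1 x^-1 y x y x^-1] and [theta u * u] to [x y x^-1 y^-1 x^-1 y]; each of
    them is equivalent to [x y x = y x y]. Hence [x0 |-> x], [x1 |-> y^-1]
    defines mutually inverse homomorphisms between the two groups. *)

Set Implicit Arguments.
Unset Strict Implicit.
Unset Printing Implicit Defensive.

Local Open Scope group_scope.

(* [gmulf1] and [gmulfV] require a [UMagmaMorphism], which a [{multiplicative _}]
   map between groups is not canonically. *)
Section GroupMorphism.
Variables (G H : groupType) (h : {multiplicative G -> H}).

Lemma group_morph1 : h 1 = 1.
Proof. by apply: (mulgI (h 1)); rewrite -gmulfM !mulg1. Qed.

Lemma group_morphV : {morph h : g / g^-1}.
Proof.
by move=> g; apply: (mulgI (h g)); rewrite -gmulfM !mulgV group_morph1.
Qed.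

End GroupMorphism.

Section QuotientMorphism.
Variables (G : groupType) (R : set G).

Lemma quot_piM : {morph quot_pi R : g k / g * k}.
Proof. by move=> g k; rewrite -quot_mul_pi. Qed.

HB.instance Definition _ :=
  isMultiplicative.Build G (quotGroup R) (quot_pi R) quot_piM.

End QuotientMorphism.

Section QuotientLift.
Variables (G H : groupType) (R : set G).
Variable h : {multiplicative G -> H}.
Hypothesis hR : forall r, R r -> h r = 1.

Lemma normal_closure_ker g : normal_closure R g -> h g = 1.
Proof.
elim=> {g} [r /hR //||g k _ hg _ hk|g _ hg|g k _ hg].
- exact: group_morph1.
- by rewrite gmulfM hg hk mulg1.
- by rewrite group_morphV hg invg1.
- by rewrite /conjg !gmulfM hg group_morphV mul1g mulVg.
Qed.

Definition quot_lift (a : quotGroup R) : H := h (repr a).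

Lemma quot_lift_pi g : quot_lift (quot_pi R g) = h g.
Proof.
have e := normal_closure_ker (quot_repr_pi R g).
(* [g] is its chosen representative times an element of the normal closure, and [h] kills the second
   factor. *)
by rewrite -[g in RHS](mulVKg (repr (quot_pi R g))) gmulfM e mulg1.
Qed.

Lemma quot_liftM : {morph quot_lift : a b / a * b}.
Proof.
elim/quot_piW=> g; elim/quot_piW=> k.
by rewrite -quot_piM !quot_lift_pi gmulfM.
Qed.

End QuotientLift.

Section Presentation.
Variables (X : choiceType) (R : set (freeGroup X)).

Definition pres_gen (x : X) : presentedGroup R := quot_pi R (free_gen x).

(** Von Dyck's theorem: the existence half of the universal property of a presentation. *)
Lemma presented_lift (G : groupType) (f : X -> G) :
  (forall r, R r -> free_lift f r = 1) ->
  exists h : {multiplicative presentedGroup R -> G},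
    forall x, h (pres_gen x) = f x.
Proof.
move=> fR.
pose m := isMultiplicative.Build _ _ _ (quot_liftM fR).
pose h : {multiplicative presentedGroup R -> G} :=
  HB.pack (@quot_lift _ _ R (free_lift f)) m.
by exists h => x; rewrite [LHS](quot_lift_pi fR) [LHS]free_lift_gen.
Qed.

(** The uniqueness half; it serves to identify both composites with the identity. *)
Lemma presented_morph_ext (G : groupType)
    (h k : {multiplicative presentedGroup R -> G}) :
  (forall x, h (pres_gen x) = k (pres_gen x)) -> h =1 k.
Proof.
move=> ehk; elim/quot_piW.
exact: (@free_morph_ext _ _ (h \o quot_pi R) (k \o quot_pi R)).
Qed.

(** [free_lift pres_gen] is the projection [quot_pi R], since the two agree on free generators. *)
Lemma presented_relator r : R r -> free_lift pres_gen r = 1.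
Proof.
move=> Rr.
rewrite (@free_morph_ext _ _ (free_lift pres_gen) (quot_pi R)) => [|x].
  by apply/quot_pi_eq; rewrite mulg1; apply/NclV/NclIn.
exact: free_lift_gen.
Qed.

End Presentation.

Section Relators.
Variables (G : groupType) (f : 'I_2 -> G) (p q : G).
Hypothesis f0 : f ord0 = p.

Lemma free_lift_braid :
  f ord_max = q ->
  free_lift f ((x0 * x1 * x0) * (x1 * x0 * x1)^-1) =
  (p * q * p) * (q * p * q)^-1.
Proof. by move=> f1; rewrite !gmulfM group_morphV !gmulfM /= !free_lift_gen f0 f1. Qed.

Hypothesis f1 : f ord_max = q^-1.

Lemma free_lift_u : free_lift f u = p * q^-1 * p^-1 * q ^+ 2.
Proof.
by rewrite !gmulfM !group_morphV !gmulfM /= !free_lift_gen f0 f1 invgM invgK.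
Qed.

Lemma free_lift_theta_u : free_lift f (theta u) = q^-1 * p * q * p ^- 2.
Proof.
rewrite !gmulfM !group_morphV !gmulfM /= theta_x0 theta_x1.
by rewrite /= !free_lift_gen f0 f1 invgK.
Qed.

(** The inner [q ^+ 2 * q^-1] collapses to [q]. The grouping isolates [q * p * q]; replacing it by
    [p * q * p] leaves [p * p * p ^- 2]. *)
Lemma u_theta_uE :
  free_lift f (u * theta u) = p * (p * q)^-1 * (q * p * q) * p ^- 2.
Proof.
rewrite free_liftM free_lift_u free_lift_theta_u !expg2.
by rewrite !invgM !mulgA mulgK.
Qed.

(** Here [p ^- 2 * p] collapses to [p^-1]; replacing [p * q * p] by [q * p * q] leaves
    [q ^- 2 * q ^+ 2]. *)
Lemma theta_u_uE :
  free_lift f (theta u * u) = q^-1 * p * q * (p * q * p)^-1 * q ^+ 2.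
Proof.
rewrite free_liftM free_lift_u free_lift_theta_u !expg2.
by rewrite !invgM !mulgA mulgVK.
Qed.

Lemma Q21_relators_of_braid :
  p * q * p = q * p * q ->
  free_lift f (u * theta u) = 1 /\ free_lift f (theta u * u) = 1.
Proof.
move=> pq; rewrite u_theta_uE theta_u_uE; split.
  by rewrite -pq expg2 !gnorm.
by rewrite pq expg2 !gnorm.
Qed.

(** The relator reads [p * ((p * q)^-1 * (q * p * q)) = p * p]; cancel the leading [p], then move
    [p * q] across. *)
Lemma braid_of_Q21_relator :
  free_lift f (u * theta u) = 1 -> p * q * p = q * p * q.
Proof.
rewrite u_theta_uE => /divg1_eq; rewrite expg2 -(mulgA p).
by move/mulgI/(canRL (mulVKg _)).
Qed.

End Relators.

Section Twist.
Variables (G : groupType) (f : 'I_2 -> G).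

(** The change of generators on the level of images; being an involution, it defines the maps in
    both directions. *)
Definition twist (i : 'I_2) : G := if i == ord0 then f i else (f i)^-1.

Lemma twist0 : twist ord0 = f ord0.
Proof. by []. Qed.

Lemma twist1 : twist ord_max = (f ord_max)^-1.
Proof. by []. Qed.

End Twist.

Lemma gmulf_twist (G H : groupType) (h : {multiplicative G -> H}) f i :
  h (twist f i) = twist (h \o f) i.
Proof. by rewrite /twist; case: ifP => _ //; apply: group_morphV. Qed.

Lemma twist_eqK (G : groupType) (f g : 'I_2 -> G) i :
  g =1 twist f -> twist g i = f i.
Proof. by move=> e; rewrite /twist e /twist; case: (i == ord0); rewrite ?invgK. Qed.

Theorem lemma5p8 :
  exists f : {multiplicative Q21 -> trefoilGroup}, bijective f.
Proof.
pose a := @pres_gen _ [set r | r = u * theta u \/ r = theta u * u]%classic.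
pose x := @pres_gen _
  [set r | r = (x0 * x1 * x0) * (x1 * x0 * x1)^-1]%classic.
have [|h hE] := @presented_lift _
    [set r | r = u * theta u \/ r = theta u * u]%classic trefoilGroup (twist x).
  have /divg1_eq br : x ord0 * x ord_max * x ord0 /
      (x ord_max * x ord0 * x ord_max) = 1.
    by rewrite -(@free_lift_braid _ x) //; apply: presented_relator.
  have [e1 e2] := Q21_relators_of_braid (twist0 x) (twist1 x) br.
  by move=> r [] ->.
have [|k kE] := @presented_lift _
    [set r | r = (x0 * x1 * x0) * (x1 * x0 * x1)^-1]%classic Q21 (twist a).
  move=> _ ->; rewrite (free_lift_braid (twist0 a) (twist1 a)).
  (* Here [q] is [(a ord_max)^-1], so that [a ord_max = q^-1] holds by [invgK]. *)
  rewrite (@braid_of_Q21_relator _ a) ?mulgV ?invgK //.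
  by apply: presented_relator; left.
exists h, k.
  apply: (@presented_morph_ext _ _ _ (k \o h) idfun) => i /=.
  (* [k] commutes with [twist] and [k \o x] is [twist a] pointwise, so the two twists cancel. *)
  by rewrite hE gmulf_twist; apply: twist_eqK => j; apply: kE.
apply: (@presented_morph_ext _ _ _ (h \o k) idfun) => i /=.
by rewrite kE gmulf_twist; apply: twist_eqK => j; apply: hE.
Qed.
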